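(* Let $n\geq 2$ and let $G(J(P_n)^2)=\{U_1,\ldots,U_p\}$, indexed so that $U_1>_{\mathcal R}U_2>_{\mathcal R}\cdots>_{\mathcal R}U_p$ in the rooted order on $F(J(P_n)^2)$. Then $J(P_n)^2$ has linear quotients with respect to the order $U_1,\ldots,U_p$; that is, for every $2\leq r\leq p$ the colon ideal $(U_1,\ldots,U_{r-1}):(U_r)$ is generated by a subset of $\{x_1,\ldots,x_n\}$.
   Context: Let $K$ be a field and $S=K[x_1,\ldots,x_n]$. For $m\geq 1$, $P_m$ is the path graph on vertices $x_1,\ldots,x_m$ with edges $\{x_i,x_{i+1}\}$, $1\leq i\leq m-1$. A vertex cover is a set of vertices meeting every edge; it is minimal if no proper subset is a vertex cover. The cover ideal $J(P_m)$ is generated by the monomials $\prod_{x\in C}x$ with $C$ a minimal vertex cover of $P_m$. For a monomial ideal $I$, $G(I)$ is its set of minimal monomial generators and $F(I^2)=\{uv: u,v\in G(I)\}$. The rooted list $\mathcal R(P_m)$ is defined recursively: $\mathcal R(P_1)$ is the empty list; $\mathcal R(P_2)=x_1,x_2$; $\mathcal R(P_3)=x_2,x_1x_3$; $\mathcal R(P_4)=x_1x_3,x_2x_3,x_2x_4$; for $m\geq5$, if $\mathcal R(P_{m-2})=u_1,\ldots,u_r$ and $\mathcal R(P_{m-3})=v_1,\ldots,v_s$, then $\mathcal R(P_m)=x_{m-1}u_1,\ldots,x_{m-1}u_r,x_mx_{m-2}v_1,\ldots,x_mx_{m-2}v_s$. For $m\geq2$ this lists each element of $G(J(P_m))$ exactly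 once. If $\mathcal R(P_m)=w_1,\ldots,w_t$, the rooted order on $G(J(P_m))$ is $w_i>_{\mathcal R}w_j$ iff $i<j$. Writing $\mathcal R(P_m)=u_1,\ldots,u_q$, each $M\in F(J(P_m)^2)$ can be written as $u_1^{a_1}\cdots u_q^{a_q}$ with $a_i\geq0$, $\sum a_i=2$; the maximal expression of $M$ is the one whose exponent vector $(a_1,\ldots,a_q)$ is lexicographically largest (first nonzero entry of the difference positive). The rooted order on $F(J(P_m)^2)$: $M>_{\mathcal R}N$ iff the exponent vector of the maximal expression of $M$ is lexicographically larger than that of $N$. *)

(* Defs.v *)
From HB Require Import structures.
From mathcomp Require Import all_boot all_algebra.
From mathcomp Require Import mpoly.
Set Implicit Arguments. Unset Strict Implicit. Unset Printing Implicit Defensive.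
Import GRing.Theory.
Local Open Scope ring_scope.

(* Variables x_1,...,x_n of S = K[x_1..x_n] are 'X_i, i : 'I_n  (x_{i+1} = 'X_i). *)

Section Defs.
Variables (K : fieldType) (n : nat).
Notation S := {mpoly K[n]}.

(* edges {x_i, x_{i+1}}: in 0-based indices, {i, j} with j = i+1 *)
Definition is_vertex_cover (C : {set 'I_n}) : Prop :=
  forall i j : 'I_n, nat_of_ord j = (nat_of_ord i).+1 -> i \in C \/ j \in C.

Definition is_min_vertex_cover (C : {set 'I_n}) : Prop :=
  is_vertex_cover C /\ forall D : {set 'I_n}, D \proper C -> ~ is_vertex_cover D.

Definition cover_monomial (C : {set 'I_n}) : S := \prod_(i in C) 'X_i.

Definition in_GJ (u : S) : Prop :=
  exists C, is_min_vertex_cover C /\ u = cover_monomial C.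

Definition in_FJ2 (M : S) : Prop :=
  exists u v, in_GJ u /\ in_GJ v /\ M = u * v.

Definition mdivides (u v : S) : Prop := exists w : S, v = u * w.

(* G(J(P_n)^2): minimal monomial generators; J^2 is generated by F(J^2), so
   these are the divisibility-minimal elements of F(J^2). *)
Definition in_GJ2 (M : S) : Prop :=
  in_FJ2 M /\ forall N, in_FJ2 N -> mdivides N M -> N = M.

(* a squarefree monomial is recorded as the list of its (1-based) variable indices *)
Fixpoint rooted_aux (k : nat) : seq (seq nat) * seq (seq nat) * seq (seq nat) :=
  (* = (R(P_{k+2}), R(P_{k+3}), R(P_{k+4})) *)
  match k with
  | 0 => ([:: [:: 1%N]; [:: 2%N]],
          [:: [:: 2%N]; [:: 1%N; 3%N]],
          [:: [:: 1%N; 3%N]; [:: 2%N; 3%N]; [:: 2%N; 4%N]])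
  | k'.+1 =>
      let: (A, B, C) := rooted_aux k' in
      (* R(P_m), m = k+4: x_{m-1} R(P_{m-2}), x_m x_{m-2} R(P_{m-3}) *)
      (B, C, [seq (k.+3 :: u) | u <- B] ++ [seq (k.+4 :: k.+2 :: v) | v <- A])
  end.

Definition rooted_list_idx (m : nat) : seq (seq nat) :=
  if (m < 2)%N then [::] else (rooted_aux (m - 2)).1.1.

Definition idx_monomial (s : seq nat) : S := \prod_(i : 'I_n | (i.+1 \in s)) 'X_i.

Definition rooted_list : seq S := [seq idx_monomial s | s <- rooted_list_idx n].

Definition lex_lt (a b : seq nat) : Prop :=
  exists k, take k a = take k b /\ (nth 0%N a k < nth 0%N b k)%N.

Definition is_expression (M : S) (a : seq nat) : Prop :=
  let us := rooted_list in
  size a = size us /\ sumn a = 2%N /\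
  M = \prod_(i < size us) (us`_i) ^+ (nth 0%N a i).

Definition is_max_expression (M : S) (a : seq nat) : Prop :=
  is_expression M a /\ forall b, is_expression M b -> b = a \/ lex_lt b a.

Definition rooted_gt (M N : S) : Prop :=
  exists a b, is_max_expression M a /\ is_max_expression N b /\ lex_lt b a.

Definition in_ideal (gs : seq S) (f : S) : Prop :=
  exists cs : seq S, size cs = size gs /\ f = \sum_(i < size gs) cs`_i * gs`_i.

Definition in_colon (gs : seq S) (u : S) (f : S) : Prop := in_ideal gs (f * u).

Definition linear_quotients (Us : seq S) : Prop :=
  forall r, (1 <= r < size Us)%N ->
    exists V : seq 'I_n,
      forall f, in_colon (take r Us) Us`_r f <-> in_ideal [seq 'X_i | i <- V] f.

End Defs.

(* Main.v *)
Require Import Defs.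
From HB Require Import structures.
From mathcomp Require Import all_boot all_algebra.
From mathcomp Require Import mpoly.
From mathcomp Require Import zify.

(** The rooted order on the minimal vertex covers of a path is reverse
    lexicographic: of two covers, the larger one misses the largest vertex at
    which they differ.  Hence the maximal expression of a generator is its
    best pair (u, v) of covers, pairs being compared lexicographically.

    Any pair of covers (x, y) can be improved to a pair (f, g), at least as
    good as (x, y), with f + g <= x + y a minimal 2-cover: while x + y has a
    redundant unit at a vertex i, remove it, exchanging x and y below i if
    necessary; this makes the pair better.  So it suffices, given minimal
    generators with best pairs (u', v') better than (u, v), to find a vertex k
    with u'_k + v'_k > u_k + v_k and a pair of covers better than (u, v) with
    sum at most u + v + e_k.  If u and u' differ, let i be the largest vertex
    where they do; then i lies in u but not in u', and k = i - 1 works with the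
    pair (u - e_i + e_k, v).  The inequality at k can fail only if k lies in v,
    but then exchanging u and v below i and dropping i from the first cover
    would give a pair below u + v better than (u, v).  If u = u', the same shift
    applied to v works. *)

(** * Covers as functions *)

(* A cover of the path on 1, ..., n is given by its characteristic function on
   [nat], which vanishes outside [1, n]. *)
Definition vcover (n : nat) (f : nat -> bool) : Prop :=
  (forall i, f i -> 0 < i <= n) /\ (forall i, 0 < i < n -> f i || f i.+1).

Definition min_vcover (n : nat) (f : nat -> bool) : Prop :=
  vcover n f /\
  forall i, f i -> (1 < i /\ f i.-1 = false) \/ (i < n /\ f i.+1 = false).

(* [revlt f g] says that [f] precedes [g] in the rooted list. *)
Definition revlt (f g : nat -> bool) : Prop :=
  exists i, [/\ f i = false, g i = true & forall j, i < j -> f j = g j].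

(** Smaller means better: as with [revlt], the smaller pair is the one that comes earlier. *)
Definition pairlt (x y u v : nat -> bool) : Prop :=
  revlt x u \/ (x =1 u /\ revlt y v).

(** With [f = g] this deletes or inserts [i]; for distinct covers the two ways of gluing exchange
    them below [i]. *)
Definition glue (f : nat -> bool) (b : bool) (g : nat -> bool) (i : nat) : nat -> bool :=
  fun j => if j < i then f j else if j == i then b else g j.

Lemma revlt_irr f g : f =1 g -> ~ revlt f g.
Proof. by move=> fg [i [fi gi _]]; rewrite fg gi in fi. Qed.

Lemma revlt_trans f g h : revlt f g -> revlt g h -> revlt f h.
Proof.
move=> [i [fi gi fg]] [j [gj hj gh]].
case: (ltngtP i j) => ij.
- exists j; split=> //; first by rewrite fg.
  by move=> k jk; rewrite fg ?gh //; lia.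
- exists i; split=> //; first by rewrite -gh.
  by move=> k jk; rewrite fg ?gh //; lia.
- by rewrite ij gj in gi.
Qed.

Lemma eq_revlt f f' g g' : f =1 f' -> g =1 g' -> revlt f g -> revlt f' g'.
Proof.
move=> ef eg [i [fi gi fg]]; exists i; split; rewrite -?ef -?eg //.
by move=> j ij; rewrite -ef -eg fg.
Qed.

Lemma pairlt_trans x y u v s t :
  pairlt x y u v -> pairlt u v s t -> pairlt x y s t.
Proof.
move=> [xu|[xu yv]] [us|[us vt]].
- by left; apply: revlt_trans xu us.
- by left; apply: eq_revlt xu.
- by left; apply: eq_revlt us => // j; rewrite xu.
- right; split; first by move=> j; rewrite xu.
  exact: revlt_trans yv vt.
Qed.

(** Only the edges at [i] meet more than one of the three pieces. If [b] holds, [i] covers them;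
    otherwise its neighbours must. *)
Lemma cover_glue n f b g i : vcover n f -> vcover n g -> 0 < i <= n ->
  (b = false -> (1 < i -> f i.-1) /\ (i < n -> g i.+1)) ->
  vcover n (glue f b g i).
Proof.
move=> [sf cf] [sg cg] ri hb; split=> j; rewrite /glue.
  by case: ltnP => _; [exact: sf | case: eqP => [-> //|_]; exact: sg].
move=> rj; case: (ltngtP j i) => ji.
- case: (ltngtP j.+1 i) => ji1; first exact: cf.
    lia.
  case: b hb => [_|[//|hb _]]; first by rewrite orbT.
  by rewrite -ji1 /= in hb; rewrite hb //; lia.
- have -> : (j.+1 < i) = false by lia.
  have -> : (j.+1 == i) = false by lia.
  exact: cg.
- rewrite ji in rj *; rewrite ltnNge leqnSn /= gtn_eqF //.
  by case: b hb => // [[//|_ hb]]; rewrite hb //; lia.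
Qed.

Lemma revlt_glue_at f g i : g i = true -> revlt (glue f false g i) g.
Proof.
move=> gi; exists i; rewrite /glue ltnn eqxx; split=> // j ij.
by rewrite ltnNge (ltnW ij) /= gtn_eqF.
Qed.

Lemma revlt_glue_below f g i : 0 < i -> f i.-1 = false -> g i.-1 = true ->
  revlt (glue f (g i) g i) g.
Proof.
move=> i0 fi gi; exists i.-1; rewrite /glue; split=> //.
  by rewrite prednK // leqnn.
move=> j ij; have -> : (j < i) = false by lia.
by case: eqP => [->|].
Qed.

(* Removing one unit at [i] from the 2-cover [x + y]: when neither cover can
   lose [i], the two neighbours of [i] lie in different covers, and exchanging
   [x] and [y] below [i] realigns them. *)
Lemma remove_unit n x y i : vcover n x -> vcover n y -> 0 < i <= n ->
  0 < x i + y i ->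
  (1 < i -> 2 < x i.-1 + y i.-1 + (x i + y i)) ->
  (i < n -> 2 < x i + y i + (x i.+1 + y i.+1)) ->
  exists x' y', [/\ vcover n x', vcover n y',
    forall j, x' j + y' j + (j == i) = x j + y j & pairlt x' y' x y].
Proof.
move=> cx cy ri di dl dr.
have glx : x i -> (1 < i -> x i.-1) -> (i < n -> x i.+1) ->
  exists x' y', [/\ vcover n x', vcover n y',
    forall j, x' j + y' j + (j == i) = x j + y j & pairlt x' y' x y].
  move=> xi xl xr; exists (glue x false x i), y; split=> //.
  - exact: cover_glue.
  - by move=> j; rewrite /glue; case: ltngtP => // [||->]; lia.
  - by left; apply: revlt_glue_at.
have gly : y i -> (1 < i -> y i.-1) -> (i < n -> y i.+1) ->
  exists x' y', [/\ vcover n x', vcover n y',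
    forall j, x' j + y' j + (j == i) = x j + y j & pairlt x' y' x y].
  move=> yi yl yr; exists x, (glue y false y i); split=> //.
  - exact: cover_glue.
  - by move=> j; rewrite /glue; case: ltngtP => // [||->]; lia.
  - by right; split=> //; apply: revlt_glue_at.
case xi: (x i) di dl dr glx => di dl dr glx; last first.
  by apply: gly; case: (y i) di dl dr => //; case: (y i.-1); case: (y i.+1);
    case: (x i.-1); case: (x i.+1) => //; lia.
case yi: (y i) di dl dr gly => di dl dr gly; last first.
  by apply: glx => //; case: (y i.-1) dl dr; case: (y i.+1);
    case: (x i.-1); case: (x i.+1) => //; lia.
case: (ltnP 1 i) dl glx gly => [i1 /(_ isT) dl glx gly|i1 _ glx gly]; last first.
  case xr: (x i.+1) glx dr => glx dr; first by apply: glx.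
  by apply: gly => // /dr; case: (y i.+1).
case: (ltnP i n) dr glx gly => [i2 /(_ isT) dr glx gly|i2 _ glx gly]; last first.
  case xl: (x i.-1) glx dl => glx dl; first by apply: glx.
  by apply: gly => // _; move: dl; case: (y i.-1).
case xl: (x i.-1) dl glx => dl glx; case xr: (x i.+1) dr glx => dr glx;
  do ?by apply: glx.
- have {}yr : y i.+1 by move: dr; case: (y i.+1).
  case yl: (y i.-1) gly => gly; first by apply: gly.
  (* Here [x] contains [i.-1] and [y] contains [i.+1], so the cover following [x] below [i] and [y]
     above can drop [i]. It goes second: the other one agrees with [x] from [i] on but lacks [i.-1],
     hence precedes [x]. *)
  exists (glue y true x i), (glue x false y i); split.
  + exact: cover_glue.
  + by apply: cover_glue.
  + by move=> j; rewrite /glue; case: ltngtP => // [||->]; rewrite ?xi ?yi; lia.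
  + by left; rewrite -xi; apply: revlt_glue_below => //; lia.
- have {}yl : y i.-1 by move: dl; case: (y i.-1).
  (* The mirror case: the cover that drops [i] now agrees with [x] above [i], so it goes first. *)
  exists (glue y false x i), (glue x true y i); split.
  + by apply: cover_glue.
  + exact: cover_glue.
  + by move=> j; rewrite /glue; case: ltngtP => // [||->]; rewrite ?xi ?yi; lia.
  + by left; apply: revlt_glue_at.
- by apply: gly => // _; [move: dl; case: (y i.-1) | move: dr; case: (y i.+1)].
Qed.

(** Local form of minimality of a 2-cover: every vertex of the support lies on an edge of weight at
    most 2, which cannot spare a unit. *)
Definition min2 n (d : nat -> nat) : Prop :=
  forall i, 0 < i <= n -> 0 < d i ->
    (1 < i /\ d i.-1 + d i <= 2) \/ (i < n /\ d i + d i.+1 <= 2).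

(** Induction on the total weight: a vertex violating [min2] meets the hypotheses of [remove_unit],
    which lowers the weight by one and improves the pair. *)
Lemma reduce_to_min2 n x y : vcover n x -> vcover n y ->
  exists f g, [/\ vcover n f, vcover n g, forall j, f j + g j <= x j + y j,
    (f =1 x /\ g =1 y) \/ pairlt f g x y & min2 n (fun j => f j + g j)].
Proof.
have [N] := ubnP (\sum_(j < n.+1) (x j + y j)).
elim: N x y => // N IH x y szN cx cy.
pose bad (i : 'I_n.+1) := [&& 0 < i, 0 < x i + y i,
  (1 < i) ==> (2 < x i.-1 + y i.-1 + (x i + y i)) &
  (i < n) ==> (2 < x i + y i + (x i.+1 + y i.+1))].
case: (pickP bad) => [i /and4P [i0 di /implyP dl /implyP dr]|nobad].
  have ri : 0 < i <= n by rewrite i0 -ltnS ltn_ord.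
  have [x' [y' [cx' cy' dd lt']]] := remove_unit n x y i cx cy ri di dl dr.
  have szN' : \sum_(j < n.+1) (x' j + y' j) < N.
    move: szN; under eq_bigr => j _ do rewrite -dd.
    rewrite big_split /= [X in _ + X < _](bigD1 i) //= eqxx; lia.
  have [f [g [cf cg le' lt'' m2]]] := IH x' y' szN' cx' cy'.
  exists f, g; split=> //.
  - by move=> j; apply: leq_trans (le' j) _; rewrite -dd leq_addr.
  - right; case: lt'' => [[fx gy]|lt'']; last exact: pairlt_trans lt'' lt'.
    case: lt' => [r|[xx r]]; first by left; apply: eq_revlt r => // j; rewrite fx.
    by right; split; [move=> j; rewrite fx xx | apply: eq_revlt r => // j; rewrite gy].
exists x, y; split=> //; first by left.
move=> i ri di; have il : i < n.+1 by lia.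
move: (nobad (Ordinal il)); rewrite /bad /= di.
have -> /= : 0 < i by lia.
move/negbT; rewrite negb_and !negb_imply.
by case/orP => /andP[-> h]; [left|right]; split=> //; rewrite leqNgt.
Qed.

Lemma cover_pair_ge2 n f g i : vcover n f -> vcover n g -> 0 < i < n ->
  2 <= f i + g i + (f i.+1 + g i.+1).
Proof.
move=> [_ cf] [_ cg] ri; move: (cf i ri) (cg i ri).
by case: (f i); case: (g i); case: (f i.+1); case: (g i.+1).
Qed.

(** If [s + t] were smaller at [j], the edge of weight at most 2 at [j] would carry at most one unit
    of [s + t], whereas two covers put at least two units on each edge. *)
Lemma min2_minimal n f g s t : vcover n s -> vcover n t ->
  min2 n (fun j => f j + g j) -> (forall j, s j + t j <= f j + g j) ->
  forall j, 0 < j <= n -> s j + t j = f j + g j.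
Proof.
move=> cs ct m2 le j rj; apply/eqP; rewrite eqn_leq le /= leqNgt.
apply/negP => lt; have d0 : 0 < f j + g j by lia.
case: (m2 j rj d0) => [[j1 dj]|[jn dj]].
- have rj' : 0 < j.-1 < n by lia.
  have := cover_pair_ge2 n s t _ cs ct rj'; have := le j.-1.
  by rewrite prednK; lia.
- have rj' : 0 < j < n by lia.
  have := cover_pair_ge2 n s t _ cs ct rj'; have := le j.+1; lia.
Qed.

(** On the edge of weight at most 2 at [i], [g] takes at least one unit and [f i] another, so [f]
    misses the neighbour and needs [i]. *)
Lemma min2_mincoverl n f g : vcover n f -> vcover n g ->
  min2 n (fun j => f j + g j) -> min_vcover n f.
Proof.
move=> cf cg m2; split=> // i fi.
have ri := proj1 cf i fi.
have d0 : 0 < f i + g i by rewrite fi.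
case: (m2 i ri d0) => [[i1 di]|[i_n di]]; [left|right]; split=> //.
- have rj : 0 < i.-1 < n by lia.
  have := proj2 cg _ rj; rewrite prednK; last by lia.
  by move: di; rewrite fi; case: (f i.-1); case: (g i.-1); case: (g i).
- have rj : 0 < i < n by lia.
  have := proj2 cg _ rj.
  by move: di; rewrite fi; case: (f i.+1); case: (g i.+1); case: (g i).
Qed.

Lemma min2_mincoverr n f g : vcover n f -> vcover n g ->
  min2 n (fun j => f j + g j) -> min_vcover n g.
Proof.
move=> cf cg m2; apply: (min2_mincoverl n g f) => // i ri; rewrite addnC => di.
by case: (m2 i ri di) => /= h; [left|right]; lia.
Qed.

(** Missing [i], the cover [u'] contains the neighbours of [i]. It agrees with [u] above [i], so
    only the edge to [i.-1] can make [i] necessary in [u]. The cover [u1] is [u] with [i] shifted to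
    [i.-1]. *)
Lemma mincover_shift n u u' i : min_vcover n u -> vcover n u' ->
  u' i = false -> u i = true -> (forall j, i < j -> u' j = u j) ->
  [/\ 1 < i <= n, u i.-1 = false, u' i.-1 = true, (i < n -> u i.+1) &
   exists2 u1, vcover n u1 & revlt u1 u /\ (forall j, u1 j <= u j + (j == i.-1))].
Proof.
move=> [cu mu] [su' cu'] u'i ui eqj.
have ri := proj1 cu i ui.
have ur : i < n -> u i.+1.
  by move=> ltn; have := cu' i; rewrite u'i -eqj //; apply; lia.
case: (mu i ui) => [[i1 ul]|[ltn]]; last by rewrite ur.
have u'l : u' i.-1 by have := cu' i.-1; rewrite prednK ?u'i ?orbF; [apply|]; lia.
split=> //; first by lia.
have cw : vcover n (glue u true u i.-1) by apply: cover_glue => //; lia.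
exists (glue (glue u true u i.-1) false u i).
  by apply: cover_glue => // _; split=> // _; rewrite /glue ltnn eqxx.
split; first by apply: revlt_glue_at.
move=> j; rewrite /glue; case: ltngtP => ji; case: ltngtP => //=; lia.
Qed.

Lemma linear_step n u v u' v' : min_vcover n u -> min_vcover n v ->
  vcover n u' -> vcover n v' ->
  (forall x y, vcover n x -> vcover n y -> (forall j, x j + y j <= u j + v j) ->
     ~ pairlt x y u v) ->
  pairlt u' v' u v ->
  exists k x y, [/\ 0 < k <= n, u k + v k < u' k + v' k, vcover n x, vcover n y &
    pairlt x y u v /\ (forall j, x j + y j <= u j + v j + (j == k))].
Proof.
move=> mu mv cu' cv' max [[i [u'i ui eqj]]|[eu [i [v'i vi eqj]]]].
  have [ri ul u'l ur [u1 cu1 [lt1 le1]]] := mincover_shift n u u' i mu cu' u'i ui eqj.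
  exists i.-1, u1, v; split=> //; first by lia.
  - rewrite ltnNge; apply/negP; rewrite ul u'l => le.
    have vl : v i.-1 by move: le; case: (v i.-1) => //; lia.
    have [cu _] := mu; have [cv _] := mv.
    (* Since [v] contains [i.-1], following [v] below [i] and [u] above covers without [i]. The
       second cover takes [i] even if [v] lacks it: the sum at [i] is then 1, at most
       [u i + v i]. *)
    apply: (max (glue v false u i) (glue u true v i)).
    + by apply: cover_glue => //; lia.
    + by apply: cover_glue => //; lia.
    + by move=> j; rewrite /glue; case: ltngtP => // [|->]; rewrite ?ui; lia.
    + by left; apply: revlt_glue_at.
  - by case: mv.
  - by split; [left | move=> j; rewrite addnAC leq_add2r].
have [ri vl v'l vr [v1 cv1 [lt1 le1]]] := mincover_shift n v v' i mv cv' v'i vi eqj.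
exists i.-1, u, v1; split=> //; first by lia.
- by rewrite eu vl v'l; lia.
- by case: mu.
- by split; [right | move=> j; rewrite -addnA leq_add2l].
Qed.

(** * The rooted list *)

Lemma eq_mincover n f g : f =1 g -> min_vcover n f -> min_vcover n g.
Proof.
move=> e [[sf cf] mf]; split; first split=> i.
- by rewrite -e; apply: sf.
- by rewrite -!e; apply: cf.
- by move=> i; rewrite -!e; apply: mf.
Qed.

Lemma mincover_penult n u : min_vcover n.+1 u ->
  min_vcover n.+3 (fun j => (j == n.+2) || u j).
Proof.
move=> [[su cu] mu]; split; first split=> i.
- by case/orP => [/eqP ->|/su]; lia.
- move=> ri; case: (ltnP i n.+1) => h.
    have /orP[->|->] : u i || u i.+1 by apply: cu; lia.
      by rewrite !orbT.
    by rewrite !orbT.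
  have [->|->] : i = n.+1 \/ i = n.+2 by lia.
    by rewrite eqxx !orbT.
  by rewrite eqxx.
- move=> i /orP[/eqP ->|ui].
    right; split=> //; have := su n.+3; case: (u n.+3) => [/(_ isT)|_]; lia.
  have ri := su i ui; case: (mu i ui) => [[i1 ui']|[i_n ui']]; [left|right];
    by rewrite ui' orbF; split=> //; lia.
Qed.

Lemma mincover_last n v : min_vcover n v ->
  min_vcover n.+3 (fun j => [|| j == n.+3, j == n.+1 | v j]).
Proof.
move=> [[sv cv] mv]; split; first split=> i.
- by case/or3P => [/eqP ->|/eqP ->|/sv]; lia.
- move=> ri; case: (ltnP i n) => h.
    have /orP[->|->] : v i || v i.+1 by apply: cv; lia.
      by rewrite !orbT.
    by rewrite !orbT.
  have [->|[->|->]] : i = n \/ i = n.+1 \/ i = n.+2 by lia.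
  + by rewrite eqxx !orbT.
  + by rewrite eqxx !orbT.
  + by rewrite eqxx !orbT.
- have vn2 : v n.+2 = false.
    by have := sv n.+2; case: (v n.+2) => [/(_ isT)|_]; lia.
  move=> i /or3P[/eqP ->|/eqP ->|vi].
  + by left; rewrite /= vn2; split=> //; lia.
  + by right; rewrite /= vn2; split=> //; lia.
  have ri := sv i vi; case: (mv i vi) => [[i1 vi']|[i_n vi']]; [left|right];
    by rewrite vi' orbF; split=> //; lia.
Qed.

(** The dichotomy behind the recursion: if the last vertex occurs, minimality excludes the one
    before, which forces [n.+1]; otherwise [n.+2] occurs. In both cases the vertex just after the
    truncated path lies in [f], so no remaining vertex is necessary only because of a removed
    edge. *)
Lemma mincover_inv n f : min_vcover n.+3 f ->
  (exists2 u, min_vcover n.+1 u & f =1 fun j => (j == n.+2) || u j) \/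
  (exists2 v, min_vcover n v & f =1 fun j => [|| j == n.+3, j == n.+1 | v j]).
Proof.
move=> [[sf cf] mf].
have f2 : f n.+2 || f n.+3 by apply: cf; lia.
case fn: (f n.+3) f2 => f2; last rewrite orbF in f2.
- have {}f2 : f n.+2 = false.
    by case: (mf _ fn) => [[_ //]|[]]; lia.
  have f1 : f n.+1 by have := cf n.+1; rewrite f2 orbF; apply; lia.
  right; exists (fun j => (j <= n) && f j); last first.
    move=> j; case: (leqP j n) => jn /=.
      by (have -> : (j == n.+3) = false by lia); (have -> : (j == n.+1) = false by lia).
    rewrite orbF; case: (ltnP j n.+4) => jn'.
      have [->|[->|->]] : j = n.+1 \/ j = n.+2 \/ j = n.+3 by lia.
      - by rewrite eqxx orbT.
      - by rewrite f2; lia.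
      - by rewrite eqxx.
    have := sf j; case: (f j) => [/(_ isT)|_]; lia.
  split; first split=> i.
  + by move=> /= /andP[? /sf]; lia.
  + by move=> /= ri; have := cf i; (have -> : i <= n by lia); (have -> : i < n by lia); apply; lia.
  + move=> i /= /andP[i_n fi]; case: (mf i fi) => [[i1 fi']|[_ fi']]; [left|right].
      by rewrite fi' andbF.
    have ni : i != n by apply/eqP => e; rewrite -e fi' in f1.
    by rewrite fi' andbF; split=> //; lia.
left; exists (fun j => (j <= n.+1) && f j); last first.
  move=> j; case: (leqP j n.+1) => jn /=; first by (have -> : (j == n.+2) = false by lia).
  rewrite orbF; case: (ltnP j n.+4) => jn'.
    have [->|->] : j = n.+2 \/ j = n.+3 by lia.
    - by rewrite eqxx.
    - by rewrite fn; lia.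
  have := sf j; case: (f j) => [/(_ isT)|_]; lia.
split; first split=> i.
+ by move=> /= /andP[? /sf]; lia.
+ by move=> /= ri; have := cf i; (have -> : i <= n.+1 by lia);
    (have -> : i < n.+1 by lia); apply; lia.
+ move=> i /= /andP[i_n fi]; case: (mf i fi) => [[i1 fi']|[_ fi']]; [left|right].
    by rewrite fi' andbF.
  have ni : i != n.+1 by apply/eqP => e; rewrite e f2 in fi'.
  by rewrite fi' andbF; split=> //; lia.
Qed.

(** Entries are read as sets, so the order of the indices inside an entry is immaterial; strict
    increase in [revlt] rules out repetitions. *)
Definition lists_mincovers (n : nat) (L : seq (seq nat)) : Prop :=
  [/\ forall s, s \in L -> min_vcover n (mem s),
      forall f, min_vcover n f -> exists2 s, s \in L & mem s =1 f &
      forall p q, p < q < size L -> revlt (mem (nth [::] L p)) (mem (nth [::] L q))].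

Lemma lists_mincovers_step n A B :
  lists_mincovers n.+1 B -> lists_mincovers n A ->
  lists_mincovers n.+3 ([seq n.+2 :: u | u <- B] ++ [seq n.+3 :: n.+1 :: v | v <- A]).
Proof.
move=> [sB cB oB] [sA cA oA]; split.
- move=> s; rewrite mem_cat => /orP[] /mapP[t tin ->].
    by apply: eq_mincover (mincover_penult _ _ (sB t tin)) => j /=; rewrite inE.
  by apply: eq_mincover (mincover_last _ _ (sA t tin)) => j /=; rewrite !inE.
- move=> f /mincover_inv[[u /cB[s sin es] ef]|[v /cA[s sin es] ef]].
    exists (n.+2 :: s); first by rewrite mem_cat map_f.
    by move=> j; rewrite ef -es /= inE.
  exists (n.+3 :: n.+1 :: s).
    by rewrite mem_cat [X in _ || X](map_f (fun v => _ :: _ :: v)) ?orbT.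
  by move=> j; rewrite ef -es /= !inE.
move=> p q; rewrite size_cat !size_map => rpq.
rewrite !nth_cat !size_map.
case: (ltnP q (size B)) => hq.
  have hp : p < size B by lia.
  rewrite hp !(nth_map [::]) //.
  have [|i [pi qi e]] := oB p q; first by lia.
  have rq : min_vcover n.+1 (mem (nth [::] B q)) by apply: sB; rewrite mem_nth.
  have ri := proj1 (proj1 rq) i qi.
  exists i; split.
  - by move: pi; rewrite /= inE => ->; lia.
  - by move: qi; rewrite /= inE => ->; rewrite orbT.
  - by move=> j ij; rewrite /= !inE; congr orb; apply: e.
have hq' : q - size B < size A by lia.
rewrite [nth _ [seq _ :: _ :: _ | _ <- _] (q - _)](nth_map [::]) //.
case: (ltnP p (size B)) => hp.
  rewrite (nth_map [::]) //.
  have [[sp _] _] : min_vcover n.+1 (mem (nth [::] B p)) by apply: sB; rewrite mem_nth.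
  have [[sq _] _] : min_vcover n (mem (nth [::] A (q - size B))) by apply: sA; rewrite mem_nth.
  (* Entries from different blocks are separated by the last vertex, which only the second block
     contains. *)
  exists n.+3; split.
  - by apply/negbTE/negP; rewrite /= inE => /orP[|/sp]; lia.
  - by rewrite /= inE eqxx.
  - move=> j ij; transitivity false; last symmetry.
      by apply/negbTE/negP; rewrite /= inE => /orP[|/sp]; lia.
    by apply/negbTE/negP; rewrite /= !inE => /or3P[||/sq]; lia.
have hp' : p - size B < size A by lia.
rewrite (nth_map [::]) //.
have [|i [pi qi e]] := oA (p - size B) (q - size B); first by lia.
have rq : min_vcover n (mem (nth [::] A (q - size B))) by apply: sA; rewrite mem_nth.
have ri := proj1 (proj1 rq) i qi.
exists i; split.
- by move: pi; rewrite /= !inE => ->; lia.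
- by move: qi; rewrite /= !inE => ->; rewrite !orbT.
- by move=> j ij; rewrite /= !inE; do 2!congr orb; apply: e.
Qed.

(** Needed because the recursion writes the indices of an entry in another order than the explicit
    lists for three and four vertices. *)
Lemma lists_mincovers_perm n L L' : lists_mincovers n L -> all2 perm_eq L L' ->
  lists_mincovers n L'.
Proof.
move=> [sL cL oL] LL'.
have eL : size L = size L' by move: LL'; rewrite all2E => /andP[/eqP].
have eqn p : p < size L -> mem (nth [::] L p) =1 mem (nth [::] L' p).
  move: LL'; rewrite all2E => /andP[_ /(all_nthP ([::], [::])) h] hp j.
  have := h p; rewrite size_zip -eL minnn hp nth_zip // => /(_ isT) /perm_mem.
  exact.
split.
- move=> s /(nthP [::])[p hp <-]; rewrite -eL in hp.
  by apply: eq_mincover (eqn p hp) _; apply: sL; rewrite mem_nth.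
- move=> f /cL[s /(nthP [::])[p hp <-] e].
  exists (nth [::] L' p); first by rewrite mem_nth -?eL.
  by move=> j; rewrite -eqn.
- move=> p q; rewrite -eL => h.
  by apply: eq_revlt (oL p q h); apply: eqn; lia.
Qed.

(** A path without edges has the empty set as its only minimal cover. With this convention the
    recursion already yields the lists for three and four vertices. *)
Lemma lists_mincovers0 : lists_mincovers 0 [:: [::]].
Proof.
split.
- by move=> s; rewrite inE => /eqP ->; split=> //; split=> // i; lia.
- move=> f [[sf _] _]; exists [::] => //= i.
  by have := sf i; case: (f i) => // /(_ isT); lia.
- by move=> p q /=; lia.
Qed.

Lemma lists_mincovers1 : lists_mincovers 1 [:: [::]].
Proof.
split.
- by move=> s; rewrite inE => /eqP ->; split=> //; split=> // i; lia.
- move=> f [[sf _] mf]; exists [::] => //= i.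
  have := mf i; have := sf i; case: (f i) => // /(_ isT) ? /(_ isT) [|][]; lia.
- by move=> p q /=; lia.
Qed.

Lemma lists_mincovers2 : lists_mincovers 2 [:: [:: 1]; [:: 2]].
Proof.
split.
- move=> s; rewrite !inE => /orP[]/eqP ->; split.
  + by split=> i /=; rewrite !inE; lia.
  + by move=> i /=; rewrite inE => /eqP ->; right.
  + by split=> i /=; rewrite !inE; lia.
  + by move=> i /=; rewrite inE => /eqP ->; left.
- move=> f [[sf cf] mf]; have f3 i : 2 < i -> f i = false.
    by move=> ?; have := sf i; case: (f i) => // /(_ isT); lia.
  have f0 : f 0 = false by have := sf 0; case: (f 0) => // /(_ isT).
  have f12 : f 1 || f 2 by apply: cf.
  case f1: (f 1) f12 => /= f2.
    have {}f2 : f 2 = false by case: (mf 1 f1) => [][].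
    by exists [:: 1] => // -[|[|[|i]]] //=; rewrite ?f0 ?f1 ?f2 ?f3.
  by exists [:: 2] => // -[|[|[|i]]] //=; rewrite ?f0 ?f1 ?f2 ?f3.
- move=> p q /= h; have [-> ->] : p = 0 /\ q = 1 by lia.
  by exists 2; split=> // j; rewrite /= !inE; lia.
Qed.

Lemma rooted_aux_mincovers k :
  [/\ lists_mincovers k.+2 (rooted_aux k).1.1,
      lists_mincovers k.+3 (rooted_aux k).1.2 &
      lists_mincovers k.+4 (rooted_aux k).2].
Proof.
elim: k => [|k] /=.
  split; first exact: lists_mincovers2.
  - exact: lists_mincovers_perm (lists_mincovers_step 0 _ _ lists_mincovers1 lists_mincovers0) _.
  - exact: lists_mincovers_perm (lists_mincovers_step 1 _ _ lists_mincovers2 lists_mincovers1) _.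
case: (rooted_aux k) => [[A B] C] /= [hA hB hC]; split=> //.
exact: lists_mincovers_step.
Qed.

Lemma rooted_list_idx_mincovers n : 2 <= n -> lists_mincovers n (rooted_list_idx n).
Proof.
case: n => [|[|n]] // _; rewrite /rooted_list_idx /= !subSS subn0.
by have [] := rooted_aux_mincovers n.
Qed.

Import GRing.Theory.
Local Open Scope ring_scope.

(** * Exponent vectors and monomials *)

Lemma eq_sum_deltas p q s t : (p <= q)%N -> (s <= t)%N ->
  (forall j, (j == p) + (j == q) = (j == s) + (j == t))%N -> p = s /\ q = t.
Proof.
move=> pq st h; case: (ltngtP p s) => ps.
- by have := h p; rewrite eqxx (ltn_eqF ps) (ltn_eqF (leq_trans ps st)).
- by have := h s; rewrite eqxx (ltn_eqF ps) (ltn_eqF (leq_trans ps pq)).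
- by have := h t; rewrite ps eqxx => /addnI; case: eqP.
Qed.

Definition idx_lt (p q s t : nat) : Prop := (p < s)%N \/ p = s /\ (q < t)%N.

(** The order reverses: a larger exponent vector has a smaller sorted index pair. At the first
    difference [k] the entry of [b] is nonzero, so [k] is [s] or [t], and [s <= k]. *)
Lemma lex_lt_deltas a b p q s t : (p <= q)%N -> (s <= t)%N ->
  size a = size b ->
  (forall j, nth 0%N a j = (j == p) + (j == q))%N ->
  (forall j, nth 0%N b j = (j == s) + (j == t))%N ->
  lex_lt a b -> idx_lt s t p q.
Proof.
move=> pq st sz ea eb [k [tk]]; rewrite ea eb => lt.
have e j : (j < k)%N -> ((j == p) + (j == q) = (j == s) + (j == t))%N.
  by move=> jk; rewrite -ea -eb -(nth_take 0%N jk) tk nth_take.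
have sk : (s <= k)%N.
  by move: lt; case: (eqVneq k s) => [->//|_]; case: (eqVneq k t) => [->//|_]; lia.
rewrite /idx_lt; case: (ltngtP s p) => sp; first by left.
  have := e p (leq_trans sp sk).
  by rewrite eqxx (ltn_eqF sp) (ltn_eqF (leq_trans sp st)).
right; split=> //; move: lt; rewrite sp ltn_add2l.
case: (eqVneq k t) => [kt|_]; last by case: (k == q).
case: (eqVneq k q) => // kq _; rewrite ltn_neqAle -kt kq /= leqNgt.
apply/negP => qk; have := e q qk; rewrite sp => /addnI.
by rewrite eqxx -kt (ltn_eqF qk).
Qed.

Lemma sumn0_nth (a : seq nat) j : sumn a = 0%N -> nth 0%N a j = 0%N.
Proof. by elim: a j => [|x a IH] [|j] //= h; [lia | apply: IH; lia]. Qed.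

Lemma sumn1_nth (a : seq nat) : sumn a = 1%N ->
  exists2 p, (p < size a)%N & forall j, nth 0%N a j = (j == p).
Proof.
elim: a => [|[|[|x]] a IH] //= h.
- have [p pa e] := IH h; exists p.+1 => //.
  by case=> [|j] //=; rewrite e eqSS.
- exists 0%N => //; case=> [|j] //=; apply: sumn0_nth; lia.
Qed.

Lemma sumn2_nth (a : seq nat) : sumn a = 2%N ->
  exists p q, (p <= q < size a)%N /\
    forall j, nth 0%N a j = ((j == p) + (j == q))%N.
Proof.
elim: a => [|[|[|[|x]]] a IH] //= h.
- have [p [q [pq e]]] := IH h; exists p.+1, q.+1; split; first by lia.
  by case=> [|j] //=; rewrite e !eqSS.
- have [|q qa e] := sumn1_nth a; first by lia.
  exists 0%N, q.+1; split; first by lia.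
  by case=> [|j] //=; rewrite e eqSS.
- exists 0%N, 0%N; split; first by lia.
  by case=> [|j] //=; rewrite sumn0_nth //; lia.
Qed.

Lemma sumn_deltas m p q : (p < m)%N -> (q < m)%N ->
  sumn (mkseq (fun j => (j == p) + (j == q))%N m) = 2%N.
Proof.
move=> pm qm; rewrite sumnE big_map -[m]subn0 -/(index_iota 0 m) big_mkord big_split /=.
have d r : (r < m)%N -> (\sum_(i < m) (i == r :> nat) = 1)%N.
  move=> rm; rewrite (bigD1 (Ordinal rm)) //= eqxx big1 // => i.
  by rewrite -val_eqE /= => /negbTE ->.
by rewrite !d.
Qed.

Lemma prod_deltas (R : comNzRingType) (us : seq R) p q :
  (p < size us)%N -> (q < size us)%N ->
  \prod_(i < size us) us`_i ^+ ((i == p :> nat) + (i == q :> nat)) = us`_p * us`_q.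
Proof.
move=> pm qm; under eq_bigr => i _ do rewrite exprD.
have d r : (r < size us)%N -> \prod_(i < size us) us`_i ^+ (i == r :> nat) = us`_r.
  move=> rm; rewrite (bigD1 (Ordinal rm)) //= eqxx expr1 big1 ?mulr1 // => i.
  by rewrite -val_eqE /= => /negbTE ->.
by rewrite big_split /= !d.
Qed.

Lemma expressionP (K : fieldType) n (M : {mpoly K[n]}) a : is_expression M a ->
  exists p q, [/\ (p <= q < size (rooted_list K n))%N,
    forall j, nth 0%N a j = ((j == p) + (j == q))%N &
    M = (rooted_list K n)`_p * (rooted_list K n)`_q].
Proof.
move=> [sz [/sumn2_nth[p [q [pq e]]] ->]]; exists p, q; rewrite -sz; split=> //.
under eq_bigr => i _ do rewrite e.
by rewrite sz prod_deltas // -sz; lia.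
Qed.

Lemma max_expressionP (K : fieldType) n (M : {mpoly K[n]}) a :
  is_max_expression M a ->
  exists p q, [/\ (p <= q < size (rooted_list K n))%N,
    forall j, nth 0%N a j = ((j == p) + (j == q))%N,
    M = (rooted_list K n)`_p * (rooted_list K n)`_q &
    forall s t, (s < size (rooted_list K n))%N -> (t < size (rooted_list K n))%N ->
      M = (rooted_list K n)`_s * (rooted_list K n)`_t -> ~ idx_lt s t p q].
Proof.
move=> [/[dup] [[sza _]] /expressionP[p [q [pq ea eM]]] max]; exists p, q; split=> //.
set us := rooted_list K n in pq eM sza *.
(* Sorting an index pair only makes it smaller, so sorted pairs suffice. The unsorted form is kept
   because pairs of covers arrive in either order. *)
suff main s t : (s <= t)%N -> (s < size us)%N -> (t < size us)%N ->
    M = us`_s * us`_t -> ~ idx_lt s t p q.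
  move=> s t hs ht e h; case: (leqP s t) => st; first exact: (main s t).
  by apply: (main t s) => //; rewrite 1?mulrC //; move: h; rewrite /idx_lt; lia.
move=> st hs ht e h.
pose b := mkseq (fun j => (j == s) + (j == t))%N (size us).
have eb j : nth 0%N b j = ((j == s) + (j == t))%N.
  case: (ltnP j (size us)) => hj; first by rewrite nth_mkseq.
  by rewrite nth_default ?size_mkseq //; lia.
have szb : size b = size us by rewrite size_mkseq.
have: is_expression M b.
  split; first by [].
  split; first exact: sumn_deltas.
  by rewrite -/us e -prod_deltas //; apply: eq_bigr => i _; rewrite eb.
have /andP[pq' _] := pq.
case/max => [ab|].
  have [] := @eq_sum_deltas s t p q st pq'; first by move=> j; rewrite -ea -eb ab.
  by move: h; rewrite /idx_lt; lia.
move/(@lex_lt_deltas _ _ s t p q st pq'); rewrite szb sza => /(_ erefl eb ea).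
by move: h; rewrite /idx_lt; lia.
Qed.

(** Vertices are numbered from 1 and variables from 0, hence the shift. *)
Definition cvmnm n (f : nat -> bool) : 'X_{1..n} := [multinom nat_of_bool (f i.+1) | i < n].

Lemma eq_cvmnm n f g : f =1 g -> cvmnm n f = cvmnm n g.
Proof. by move=> e; apply/mnmP => i; rewrite !mnmE e. Qed.

Lemma prod_vars_cvmnm (K : fieldType) n (f : nat -> bool) :
  \prod_(i < n | f i.+1) 'X_i = 'X_[cvmnm n f] :> {mpoly K[n]}.
Proof.
rewrite mprodXE; congr 'X_[_]; apply/mnmP => j; rewrite mnm_sumE mnmE.
rewrite big_mkcond (bigD1 j) //= big1 => [|i ij].
  by rewrite mnm1E eqxx addn0; case: (f j.+1).
by rewrite mnm1E (negbTE ij); case: (f i.+1).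
Qed.

Lemma cover_setP n (f : nat -> bool) : (forall i, f i -> (0 < i <= n)%N) ->
  vcover n f <-> is_vertex_cover [set i : 'I_n | f i.+1].
Proof.
move=> sf; split=> [[_ cf] i j ij|cf].
  rewrite !inE ij; apply/orP; apply: cf; have := ltn_ord j; lia.
split=> // -[|i] // ri.
have hi : (i < n)%N by lia.
have hj : (i.+1 < n)%N by lia.
by have := cf (Ordinal hi) (Ordinal hj) erefl; rewrite !inE => /orP.
Qed.

(** A proper subset misses some vertex [k], and an edge from [k] to a neighbour outside the cover is
    then uncovered. Conversely, a vertex whose neighbours all lie in the cover can be deleted. *)
Lemma mincover_setP n (f : nat -> bool) : (forall i, f i -> (0 < i <= n)%N) ->
  min_vcover n f <-> is_min_vertex_cover [set i : 'I_n | f i.+1].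
Proof.
move=> sf; split=> [[cf mf]|[/(cover_setP n f sf) cf mf]].
  split; first exact/cover_setP.
  move=> D /properP[sDC [k]]; rewrite inE => fk kD cD.
  have nD (i : 'I_n) : f i.+1 = false -> i \notin D.
    by move=> fi; apply/negP => /(subsetP sDC); rewrite inE fi.
  have hk := ltn_ord k.
  case: (mf _ fk) => [[k1 /= fk']|[k1 fk']].
    have hj : (k.-1 < n)%N by lia.
    case: (cD (Ordinal hj) k) => [/=|h|h].
    - by lia.
    - by move: (nD (Ordinal hj)); rewrite /= prednK ?h => [/(_ fk')|].
    - by rewrite h in kD.
  case: (cD k (Ordinal k1)) => [//|h|h].
  - by rewrite h in kD.
  - by move: (nD (Ordinal k1) fk'); rewrite h.
split=> // -[|i] fi; first by have := sf _ fi.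
have hi : (i < n)%N by have := sf _ fi; lia.
have [/andP[h1 /negbTE h2]|nl] := boolP ((0 < i)%N && ~~ f i); first by left.
have [/andP[h1 /negbTE h2]|nr] := boolP ((i.+1 < n)%N && ~~ f i.+2); first by right.
case: (mf ([set j : 'I_n | f j.+1] :\ Ordinal hi)).
  by apply: properD1; rewrite inE.
move=> a b ab; have := (proj1 (cover_setP n f sf) cf) a b ab.
rewrite !inE -!val_eqE /= ab; have := ltn_ord b; rewrite ab => hb.
case: (eqVneq (a : nat) i) => [ai|_] /=; last first.
  case: (eqVneq a.+1 i) => [ai|_] //= _; left.
  by move: nl; rewrite -ai /= negbK.
by move=> _; right; move: nr; rewrite -ai hb /= negbK => ->; rewrite gtn_eqF.
Qed.

Lemma in_GJP (K : fieldType) n (u : {mpoly K[n]}) :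
  in_GJ u <-> exists2 f, min_vcover n f & u = 'X_[cvmnm n f].
Proof.
split=> [[C [mC ->]]|[f mf ->]]; last first.
  exists [set i : 'I_n | f i.+1]; split; first by apply/mincover_setP => //; case: mf => [[]].
  by rewrite -prod_vars_cvmnm; apply: eq_bigl => i; rewrite inE.
pose f j := [exists i : 'I_n, (i.+1 == j) && (i \in C)].
have fC (i : 'I_n) : f i.+1 = (i \in C).
  apply/existsP/idP => [[j /andP[/eqP [/val_inj -> //]]]|iC].
  by exists i; rewrite eqxx.
have sf j : f j -> (0 < j <= n)%N.
  by case/existsP => i /andP[/eqP <- _] /=.
exists f.
  apply/mincover_setP => //; suff -> : [set i : 'I_n | f i.+1] = C by [].
  by apply/setP => i; rewrite inE fC.
by rewrite -prod_vars_cvmnm; apply: eq_bigl => i; rewrite fC.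
Qed.

Lemma in_FJ2P (K : fieldType) n (M : {mpoly K[n]}) :
  in_FJ2 M <-> exists f g, [/\ min_vcover n f, min_vcover n g &
    M = 'X_[cvmnm n f + cvmnm n g]].
Proof.
split=> [[u [v [/in_GJP[f mf ->] [/in_GJP[g mg ->] ->]]]]|[f [g [mf mg ->]]]].
  by exists f, g; rewrite mpolyXD.
exists 'X_[cvmnm n f], 'X_[cvmnm n g]; rewrite mpolyXD.
by split; [apply/in_GJP; exists f | split; [apply/in_GJP; exists g|]].
Qed.

Lemma mdividesP (K : fieldType) n (a b : 'X_{1..n}) :
  mdivides ('X_[a] : {mpoly K[n]}) 'X_[b] <-> (a <= b)%MM.
Proof.
split=> [[w e]|ab]; last by exists 'X_[b - a]; rewrite -mpolyXD addmC submK.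
have : b \in msupp (w * 'X_[a]) by rewrite mulrC -e msuppX inE.
by rewrite (perm_mem (msuppMX _ _)) => /mapP[m _ ->]; rewrite lem_addr.
Qed.

Lemma lepm_cvmnm n (f g s t : nat -> bool) : 
  (forall j, f j + g j <= s j + t j)%N ->
  (cvmnm n f + cvmnm n g <= cvmnm n s + cvmnm n t)%MM.
Proof. by move=> h; apply/mnm_lepP => i; rewrite !mnmDE !mnmE. Qed.

(** Every term of a combination of monomials is divisible by one of them; conversely [f] is the sum
    of its terms, each a multiple of a generator. *)
Lemma in_ideal_monomials (K : fieldType) n (ms : seq 'X_{1..n}) (f : {mpoly K[n]}) :
  in_ideal [seq 'X_[m] | m <- ms] f <->
  (forall m, m \in msupp f -> exists2 m0, m0 \in ms & (m0 <= m)%MM).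
Proof.
split=> [[cs [sz ->]] m /msupp_sum_le|h].
  move=> /flattenP[s /mapP[i _ ->]]; have hi : (i < size ms)%N.
    by rewrite -(size_map (fun m => 'X_[K, m])); apply: ltn_ord.
  rewrite (nth_map 0%MM) // (perm_mem (msuppMX _ _)) => /mapP[m' _ ->].
  by exists (nth 0%MM ms i); rewrite ?mem_nth ?lem_addr.
rewrite [f]mpolyE big_seq; apply: (big_ind (in_ideal [seq 'X_[m] | m <- ms])).
- exists (nseq (size ms) 0); rewrite size_nseq size_map; split=> //.
  by rewrite big1 // => i _; rewrite nth_nseq if_same mul0r.
- move=> x y [cx [szx ->]] [cy [szy ->]].
  exists (mkseq (fun i => cx`_i + cy`_i) (size [seq 'X_[K, m] | m <- ms])).
  rewrite size_mkseq; split=> //; rewrite -big_split; apply: eq_bigr => i _.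
  by rewrite nth_mkseq // mulrDl.
- move=> m /h[m0 /(nthP 0%MM)[k hk <-] le].
  exists (mkseq (fun i => if i == k then f@_m *: 'X_[m - nth 0%MM ms k] else 0) (size ms)).
  rewrite size_mkseq size_map; split=> //.
  rewrite (bigD1 (Ordinal hk)) //= nth_mkseq // eqxx (nth_map 0%MM) //.
  rewrite -scalerAl -mpolyXD submK // big1 ?addr0 // => i.
  by rewrite -val_eqE /= nth_mkseq // => /negbTE ->; rewrite mul0r.
Qed.

(** * Linear quotients *)

(** Both covers occur in the rooted list, where their positions can be compared. *)
Lemma revlt_total n f g : (2 <= n)%N -> min_vcover n f -> min_vcover n g ->
  [\/ f =1 g, revlt f g | revlt g f].
Proof.
move=> /rooted_list_idx_mincovers[_ cL oL].
move=> /cL[s /(nthP [::])[p hp <-] ef] /cL[t /(nthP [::])[q hq <-] eg].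
case: (ltngtP p q) => pq.
- by constructor 2; apply: eq_revlt ef eg _; apply: oL; rewrite pq.
- by constructor 3; apply: eq_revlt eg ef _; apply: oL; rewrite pq.
- by constructor 1 => j; rewrite -ef -eg pq.
Qed.

Lemma pairlt_total n x y u v : (2 <= n)%N ->
  min_vcover n x -> min_vcover n y -> min_vcover n u -> min_vcover n v ->
  [\/ x =1 u /\ y =1 v, pairlt x y u v | pairlt u v x y].
Proof.
move=> n2 mx my mu mv; case: (revlt_total n x u n2 mx mu) => xu.
- case: (revlt_total n y v n2 my mv) => yv.
  + by constructor 1.
  + by constructor 2; right.
  + by constructor 3; right; split=> // j; rewrite xu.
- by constructor 2; left.
- by constructor 3; left.
Qed.

Lemma eq_pairlt x x' y y' u u' v v' : x =1 x' -> y =1 y' -> u =1 u' -> v =1 v' ->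
  pairlt x y u v -> pairlt x' y' u' v'.
Proof.
move=> ex ey eu ev [h|[e h]]; first by left; apply: eq_revlt h.
by right; split; [move=> j; rewrite -ex e eu | apply: eq_revlt h].
Qed.

Definition max_cover_pair (K : fieldType) n (M : {mpoly K[n]}) u v : Prop :=
  [/\ min_vcover n u, min_vcover n v, M = 'X_[cvmnm n u + cvmnm n v] &
   forall f g, min_vcover n f -> min_vcover n g -> M = 'X_[cvmnm n f + cvmnm n g] ->
     ~ pairlt f g u v].

Lemma nth_rooted_list (K : fieldType) n p : (p < size (rooted_list K n))%N ->
  (rooted_list K n)`_p = 'X_[cvmnm n (mem (nth [::] (rooted_list_idx n) p))].
Proof.
rewrite size_map => hp; rewrite (nth_map [::]) //.
by rewrite /idx_monomial -prod_vars_cvmnm.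
Qed.

(** Positions in the rooted list and [revlt] agree, so a better pair of covers for [M] would give a
    smaller pair of positions. *)
Lemma max_expression_cover_pair (K : fieldType) n (M : {mpoly K[n]}) a :
  (2 <= n)%N -> is_max_expression M a ->
  exists p q, [/\ (p <= q < size (rooted_list K n))%N,
    forall j, nth 0%N a j = ((j == p) + (j == q))%N &
    max_cover_pair K n M (mem (nth [::] (rooted_list_idx n) p))
                     (mem (nth [::] (rooted_list_idx n) q))].
Proof.
move=> /rooted_list_idx_mincovers[mL cL oL] /max_expressionP[p [q [pq ea eM max]]].
have szL : size (rooted_list K n) = size (rooted_list_idx n) by rewrite size_map.
have hp : (p < size (rooted_list_idx n))%N by lia.
have hq : (q < size (rooted_list_idx n))%N by lia.
exists p, q; split=> //; split.
- by apply: mL; rewrite mem_nth.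
- by apply: mL; rewrite mem_nth.
- by rewrite eM mpolyXD !nth_rooted_list ?szL.
move=> f g /cL[s' /(nthP [::])[s hs <-] ef] /cL[t' /(nthP [::])[t ht <-] eg] eM' lt.
apply: (max s t); rewrite ?szL // ?nth_rooted_list ?szL //.
  by rewrite eM' mpolyXD (eq_cvmnm _ _ _ ef) (eq_cvmnm _ _ _ eg).
case: lt => [h|[e h]].
  have {}h := eq_revlt _ _ _ _ (fsym ef) (frefl _) h.
  left; rewrite ltnNge leq_eqVlt; apply/negP => /orP[/eqP ps|ps].
    by apply: revlt_irr h; rewrite ps.
  by apply: (revlt_irr _ _ (frefl _) (revlt_trans _ _ _ h _)); apply: oL; rewrite ps.
have {}h := eq_revlt _ _ _ _ (fsym eg) (frefl _) h.
right; split.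
  case: (ltngtP s p) => // sp.
  - by case: (revlt_irr _ _ (ftrans ef e) (oL s p _)); rewrite sp.
  - by case: (revlt_irr _ _ (fsym (ftrans ef e)) (oL p s _)); rewrite sp.
rewrite ltnNge leq_eqVlt; apply/negP => /orP[/eqP ps|ps].
  by apply: revlt_irr h; rewrite ps.
by apply: (revlt_irr _ _ (frefl _) (revlt_trans _ _ _ h _)); apply: oL; rewrite ps.
Qed.

Lemma rooted_gt_cover_pairs (K : fieldType) n (M N : {mpoly K[n]}) :
  (2 <= n)%N -> rooted_gt M N ->
  exists u' v' u v, [/\ max_cover_pair K n M u' v', max_cover_pair K n N u v &
    pairlt u' v' u v].
Proof.
move=> n2 [a [b [ma [mb lt]]]].
have [[sza _] _] := ma; have [[szb _] _] := mb.
have [p' [q' [pq' ea maxa]]] := max_expression_cover_pair K n M a n2 ma.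
have [p [q [pq eb maxb]]] := max_expression_cover_pair K n N b n2 mb.
exists (mem (nth [::] (rooted_list_idx n) p')), (mem (nth [::] (rooted_list_idx n) q')).
exists (mem (nth [::] (rooted_list_idx n) p)), (mem (nth [::] (rooted_list_idx n) q)).
split=> //.
have [_ _ oL] := rooted_list_idx_mincovers n n2.
have [|||h|[-> h]] := lex_lt_deltas b a p q p' q' _ _ _ eb ea lt.
- by case/andP: pq.
- by case/andP: pq'.
- by rewrite sza szb.
- by left; apply: oL; rewrite h; move: pq; rewrite size_map; lia.
- by right; split=> //; apply: oL; rewrite h; move: pq; rewrite size_map; lia.
Qed.

Lemma cover_out n f i : vcover n f -> ~~ (0 < i <= n)%N -> f i = false.
Proof. by move=> [sf _] ri; apply/negbTE; apply: contra ri; apply: sf. Qed.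

Lemma min2_in_GJ2 (K : fieldType) n f g : vcover n f -> vcover n g ->
  min2 n (fun j => f j + g j)%N ->
  in_GJ2 ('X_[cvmnm n f + cvmnm n g] : {mpoly K[n]}).
Proof.
move=> cf cg m2; split.
  apply/in_FJ2P; exists f, g; split=> //.
    exact: min2_mincoverl m2.
  exact: min2_mincoverr m2.
move=> N /in_FJ2P[s [t [[cs _] [ct _] ->]]] /mdividesP /mnm_lepP le; congr 'X_[_].
(* Divisibility compares only the vertices from 1 to [n]; elsewhere all covers vanish. *)
have le' j : (s j + t j <= f j + g j)%N.
  have [rj|rj] := boolP (0 < j <= n)%N; last first.
    by rewrite (cover_out n s j) // (cover_out n t j) // addn0.
  have hj : (j.-1 < n)%N by lia.
  by have := le (Ordinal hj); rewrite !mnmDE !mnmE /= prednK //; lia.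
apply/mnmP => i; rewrite !mnmDE !mnmE.
apply: (min2_minimal n f g s t cs ct m2 le'); have := ltn_ord i; lia.
Qed.

(** Reducing [(x, y)] to a minimal 2-cover gives an element of [F(J^2)] dividing [M], hence [M]
    itself. The reduced pair thus competes with [(u, v)], and maximality extends to all pairs of
    covers with sum below that of [(u, v)]. *)
Lemma GJ2_max_cover_pair (K : fieldType) n (M : {mpoly K[n]}) u v :
  in_GJ2 M -> max_cover_pair K n M u v ->
  forall x y, vcover n x -> vcover n y -> (forall j, x j + y j <= u j + v j)%N ->
    ~ pairlt x y u v.
Proof.
move=> [_ minM] [mu mv eM max] x y cx cy le lt.
have [f [g [cf cg le' lt' m2]]] := reduce_to_min2 n x y cx cy.
have mf := min2_mincoverl n f g cf cg m2.
have mg := min2_mincoverr n f g cf cg m2.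
apply: (max f g) => //.
  symmetry; apply: minM; first by apply/in_FJ2P; exists f, g.
  by rewrite eM; apply/mdividesP/lepm_cvmnm => j; apply: leq_trans (le' j) (le j).
case: lt' => [[fx gy]|lt']; last exact: pairlt_trans lt' lt.
by apply: eq_pairlt lt => // j; rewrite ?fx ?gy.
Qed.

(** The exchange property behind linear quotients. That [c] comes before [N] is expressed
    negatively, which suffices once both are located in an ordered list. *)
Lemma rooted_linear_step (K : fieldType) n (M N : {mpoly K[n]}) :
  (2 <= n)%N -> in_GJ2 N -> rooted_gt M N ->
  exists (k : 'I_n) (c : {mpoly K[n]}), [/\ in_GJ2 c, c <> N, ~ rooted_gt N c,
    (mlead c <= U_(k) + mlead N)%MM & (mlead N k < mlead M k)%N].
Proof.
move=> n2 GN /(rooted_gt_cover_pairs K n M N n2).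
move=> [u' [v' [u [v [[mu' mv' eM _] maxN lt]]]]].
have maxN' := GJ2_max_cover_pair K n N u v GN maxN.
have [mu mv eN max] := maxN.
have [k [x [y [rk ltk cx cy [ltx lex]]]]] :=
  linear_step n u v u' v' mu mv (proj1 mu') (proj1 mv') maxN' lt.
have [f [g [cf cg lef ltf m2]]] := reduce_to_min2 n x y cx cy.
have mf := min2_mincoverl n f g cf cg m2.
have mg := min2_mincoverr n f g cf cg m2.
have {}ltf : pairlt f g u v.
  case: ltf => [[fx gy]|ltf]; last exact: pairlt_trans ltf ltx.
  by apply: eq_pairlt ltx => // j; rewrite ?fx ?gy.
have hk : (k.-1 < n)%N by lia.
exists (Ordinal hk), 'X_[cvmnm n f + cvmnm n g]; split.
- exact: min2_in_GJ2.
- by move=> e; apply: (max f g).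
- move=> /(rooted_gt_cover_pairs K n N _ n2).
  move=> [u2 [v2 [f2 [g2 [[mu2 mv2 eN2 max2] [mf2 mg2 ec maxc] lt2]]]]].
  (* As [(f, g)] is better than [(u, v)], it is enough that [(u2, v2)] beats [(f, g)]: it beats
     [(f2, g2)], the best pair of [c], which is no worse than [(f, g)]. *)
  apply: (max u2 v2) => //; apply: pairlt_trans ltf.
  case: (pairlt_total n f2 g2 f g n2 mf2 mg2 mf mg) => [[e1 e2]|h|h].
  + exact: eq_pairlt lt2.
  + exact: pairlt_trans lt2 h.
  + by case: (maxc f g).
- rewrite eN !mleadXm; apply/mnm_lepP => i; rewrite !mnmDE !mnmE.
  apply: leq_trans (lef i.+1) (leq_trans (lex i.+1) _).
  rewrite addnC leq_add2r -val_eqE /=; lia.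
- by rewrite eN eM !mleadXm !mnmDE !mnmE /= prednK //; lia.
Qed.

Lemma in_colon_monomials (K : fieldType) n (ms : seq 'X_{1..n}) (a : 'X_{1..n})
    (f : {mpoly K[n]}) :
  in_colon [seq 'X_[m] | m <- ms] 'X_[a] f <->
  (forall m, m \in msupp f -> exists2 m0, m0 \in ms & (m0 <= a + m)%MM).
Proof.
rewrite /in_colon in_ideal_monomials; split=> h m.
  by move=> mf; apply: h; rewrite (perm_mem (msuppMX _ _)) map_f.
by rewrite (perm_mem (msuppMX _ _)) => /mapP[m' /h h' ->].
Qed.

Theorem theorem5p1 (K : fieldType) (n : nat) (hn : (2 <= n)%N)
  (Us : seq {mpoly K[n]}) :
  uniq Us ->
  (forall M, M \in Us <-> in_GJ2 M) ->
  (forall i j, (i < j < size Us)%N -> rooted_gt Us`_i Us`_j) ->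
  linear_quotients Us.
Proof.
move=> uUs GUs oUs r /andP[_ hr].
have XUs M : M \in Us -> M = 'X_[mlead M].
  by move=> /GUs[/in_FJ2P[f [g [_ _ ->]]] _]; rewrite mleadXm.
pose ms := map (@mlead n K) (take r Us); pose a := mlead Us`_r.
have eUr : Us`_r = 'X_[a] by apply: XUs; rewrite mem_nth.
have eUs : take r Us = [seq 'X_[m] | m <- ms].
  rewrite -map_comp -[LHS]map_id; apply/eq_in_map => M /mem_take; exact: XUs.
(* The variables lying in the colon ideal: those whose product with the generator at [r] is
   divisible by an earlier one. *)
pose V := [seq k <- enum 'I_n | has (fun m => (m <= U_(k) + a)%MM) ms].
exists V => f; rewrite eUr eUs in_colon_monomials.
have -> : [seq 'X_i | i <- V] = [seq 'X_[K, m] | m <- [seq U_(i)%MM | i <- V]].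
  by rewrite -map_comp.
rewrite in_ideal_monomials; split=> h m /h [m0].
- move=> /mapP[M /(nthP 0)[j]]; rewrite size_take hr => hj.
  rewrite nth_take // => <- -> le.
  have hjs : (j < size Us)%N := ltn_trans hj hr.
  have GN : in_GJ2 Us`_r by apply/GUs; rewrite mem_nth.
  have [|k [c [/GUs/(nthP 0)[l hl <-] neq ngt lec ltk]]] :=
    rooted_linear_step K n Us`_j Us`_r hn GN; first by apply: oUs; rewrite hj.
  (* [c] sits at position [l]; a position after [r] would make the generator at [r] larger than
     [c]. *)
  have lr : (l < r)%N.
    case: (ltngtP l r) => // [rl|lr]; last by rewrite lr in neq.
    by case: ngt; apply: oUs; rewrite rl.
  exists U_(k)%MM.
    apply: map_f; rewrite mem_filter mem_enum andbT; apply/hasP.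
    exists (mlead Us`_l) => //; apply: map_f; rewrite -(nth_take 0 lr).
    by rewrite mem_nth // size_take hr.
  (* The generator at [j] has a larger exponent at [k] than the one at [r] but divides its product
     with the monomial [m], so [m] has positive exponent at [k]. *)
  apply/mnm_lepP => i; rewrite mnm1E; case: eqP => // <-.
  have := leq_trans ltk (mnm_lepP le k).
  by rewrite mnmDE -/a -[X in (X < _)%N]addn0 ltn_add2l.
- move=> /mapP[k]; rewrite mem_filter => /andP[/hasP[m1 m1in le] _] -> leU.
  exists m1 => //; apply: lepm_trans le _; rewrite addmC.
  apply/mnm_lepP => i; rewrite !mnmDE leq_add2l; exact: (mnm_lepP leU).
Qed.
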